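(* Let $(X,\mathcal S,U,f)$ be a splitting structure on a complete metric space $X$, and let $B\in\mathcal B(X)$. Then for every two sequences $(u_i)_{i\in\mathbb N}$ and $(v_i)_{i\in\mathbb N}$ with $u_i,v_i\in U$, $u_i\mid u_{i+1}$, $v_i\mid v_{i+1}$ and $u_i,v_i\to\infty$ as $i\to\infty$, one has $$\bigcap_{i=1}^\infty A_{u_i}(B)=\bigcap_{i=1}^\infty A_{v_i}(B).$$
   Context: Let $(X,\mathbf d)$ be a metric space and $\mathcal B(X)$ the set of closed balls $B(x,r)=\{y:\mathbf d(x,y)\le r\}$ of $X$, each considered with a centre $\mathrm{cent}(B)=x$ and radius $\mathrm{rad}(B)=r$. A splitting structure on $X$ is a quadruple $(X,\mathcal S,U,f)$ where: $U\subset\mathbb N$ is an infinite multiplicatively closed set such that $u,v\in U$, $u\mid v$ imply $v/u\in U$; $f:U\to\mathbb N$ is completely multiplicative; and $\mathcal S$ assigns to each $B\in\mathcal B(X)$ and $u\in U$ a collection $\mathcal S(B,u)$ of closed balls contained in $B$, each of radius $\mathrm{rad}(B)/u$, such that (S1) $\#\mathcal S(B,u)=f(u)$; (S2) distinct $b_1,b_2\in\mathcal S(B,u)$ satisfy $\mathbf d(\mathrm{cent}(b_1),\mathrm{cent}(b_2))\ge 2\,\mathrm{rad}(B)/u$; (S3) $\mathcal S(B,uv)=\bigcup_{b\in\mathcal S(B,u)}\mathcal S(b,v)$ for all $u,v\in U$. For $u\in U$ put $A_u(B):=\bigcup_{b\in\mathcal S(B,u)}b$. *)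

(* Defs.v *)
From HB Require Import structures.
From mathcomp Require Import all_boot all_order all_algebra.
From mathcomp Require Import all_classical all_reals.
From mathcomp Require Import topology metric_structure.

Set Implicit Arguments.
Unset Strict Implicit.
Unset Printing Implicit Defensive.

Import Order.TTheory GRing.Theory Num.Theory.

Local Open Scope classical_set_scope.
Local Open Scope card_scope.
Local Open Scope ring_scope.

(* The library's completeType requires a point; metricType does not, so
   completeness is stated here as a property of the metric space. *)
Definition complete_metric (R : realType) (X : metricType R) : Prop :=
  forall s : nat -> X, cauchy (s @ \oo) -> exists l : X, s @ \oo --> l.

(* A closed ball carries its centre and radius, which in a general metric space
   are not determined by its set of points. Radii are positive: allowing
   radius 0 would force f = 1 in every splitting structure. *)
Record cball (R : realType) (X : metricType R) := CBall {
  cent : X;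
  rad : R;
  rad_gt0 : 0 < rad }.

(* Not the library's closed_ball, which is the topological closure of the open
   ball and may be strictly smaller. *)
Definition cball_set (R : realType) (X : metricType R) (b : cball X) : set X :=
  [set y | mdist (cent b) y <= rad b].

(* Here N = {1, 2, ...}. The maps f and S are total functions, but only their
   values at elements of U are constrained or used. That 1 is in U and f 1 = 1
   follows from U_div, U_infinite, f_mul and f_gt0. *)
Record splitting_structure (R : realType) (X : metricType R) :=
  SplittingStructure {
  ssU : set nat;
  ssf : nat -> nat;
  ssS : cball X -> nat -> set (cball X);
  U_gt0 : forall u, ssU u -> (0 < u)%N;
  U_infinite : infinite_set ssU;
  U_mul : forall u v, ssU u -> ssU v -> ssU (u * v)%N;
  U_div : forall u v, ssU u -> ssU v -> (u %| v)%N -> ssU (v %/ u)%N;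
  f_gt0 : forall u, ssU u -> (0 < ssf u)%N;
  f_mul : forall u v, ssU u -> ssU v -> ssf (u * v)%N = (ssf u * ssf v)%N;
  S_sub : forall B u b, ssU u -> ssS B u b -> cball_set b `<=` cball_set B;
  S_rad : forall B u b, ssU u -> ssS B u b -> rad b = rad B / u%:R;
  S_card : forall B u, ssU u -> ssS B u #= `I_(ssf u);
  S_sep : forall B u b1 b2, ssU u -> ssS B u b1 -> ssS B u b2 -> b1 <> b2 ->
    2 * rad B / u%:R <= mdist (cent b1) (cent b2);
  S_mul : forall B u v, ssU u -> ssU v ->
    ssS B (u * v)%N = \bigcup_(b in ssS B u) ssS b v }.

Definition ssA (R : realType) (X : metricType R) (SS : splitting_structure X)
    (u : nat) (B : cball X) : set X :=
  \bigcup_(b in ssS SS B u) cball_set b.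

(* Main.v *)
Require Import Defs.
From HB Require Import structures.
From mathcomp Require Import all_boot all_order all_algebra.
From mathcomp Require Import all_classical all_reals.
From mathcomp Require Import topology metric_structure.
From mathcomp Require Import num_normedtype.
From mathcomp Require Import lra.
Import Defs.

(** A point [x] of the intersection along [u] lies in [A_w] for every [w] in
    [U]. Any element of [S(b, w)], where [b] in [S(B, u_i)] contains [x], is a
    ball with centre at distance at most [2 rad(B) / u_i] from [x]; by (S3) and
    commutativity it also belongs to [S(c, u_i)] for some [c] in [S(B, w)], so
    [x] is within [2 rad(B) / u_i] of one of the finitely many balls of
    [S(B, w)]. Letting [i] tend to infinity, [x] belongs to one of them. *)

Import Order.TTheory GRing.Theory Num.Theory.

Local Open Scope classical_set_scope.

Lemma filter_finite_bigcap (T I : Type) (D : set I) (f : I -> set T)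
    (F : set_system T) : Filter F -> finite_set D ->
  (forall i, D i -> F (f i)) -> F (\bigcap_(i in D) f i).
Proof.
(* A choice structure on [I] allows [D] to be written as an [fset]. *)
elim/Pchoice: I => I in D f *.
move=> FF /finite_fsetP[E ->] Ff.
by apply: filter_bigI => i iE; exact: Ff.
Qed.

Section SplittingStructure.
Local Open Scope ring_scope.
Context (R : realType) (X : metricType R) (SS : splitting_structure X).
Implicit Types (B b c : cball X) (x : X) (u w : nat).

Lemma cball_set_cent b : cball_set b (cent b).
Proof. by rewrite /cball_set/= mdistxx ltW// rad_gt0. Qed.

Lemma ssS_finite B u : ssU SS u -> finite_set (ssS SS B u).
Proof. by move=> Uu; apply/finite_setP; exists (ssf SS u); exact: S_card. Qed.

Lemma ssS_nonempty B u : ssU SS u -> ssS SS B u !=set0.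
Proof.
move=> Uu; apply/set0P/negP => /eqP S0.
have := S_card B Uu; rewrite S0 card_eq_sym card_eq0 => /eqP I0.
by have : `I_(ssf SS u) 0%N := f_gt0 Uu; rewrite I0.
Qed.

Lemma ssA_near_ssS B x u w : ssU SS u -> ssU SS w -> ssA SS u B x ->
  exists2 c, ssS SS B w c &
    mdist (cent c) x <= rad c + 2 * (rad B / u%:R).
Proof.
move=> Uu Uw [b Sb bx].
have [e Se] := ssS_nonempty b w Uw.
have : ssS SS B (w * u)%N e by rewrite mulnC S_mul//; exists b.
rewrite S_mul// => -[c Sc Sce]; exists c => //.
(* The centre of [e] lies in both [b] and [c]. Going from [cent c] to [x] through [cent e] and
   [cent b] costs [rad c] and twice [rad b]. *)
have be := S_sub Uw Se (cball_set_cent e).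
have ce := S_sub Uu Sce (cball_set_cent e).
move: bx be ce; rewrite /cball_set/= (S_rad Uu Sb) => bx be ce.
have cx := metric_triangle (cent c) (cent e) x.
have ex := metric_triangle (cent e) (cent b) x.
rewrite (metric_sym (cent e) (cent b)) in ex.
lra.
Qed.

Lemma bigcap_ssA_sub B (u : nat -> nat) w :
  (forall i, ssU SS (u i)) -> u @ \oo --> \oo -> ssU SS w ->
  \bigcap_i ssA SS (u i) B `<=` ssA SS w B.
Proof.
move=> Uu u_oo Uw x Ax; apply: contrapT => nAx.
(* If [x] is outside [c], the gap [mdist (cent c) x - rad c] is positive, and it suffices that [u i]
   exceed [2 * rad B] divided by this gap. *)
have far c : ssS SS B w c -> \forall i \near \oo,
    rad c + 2 * (rad B / (u i)%:R) < mdist (cent c) x.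
  move=> Sc; have e0 : 0 < mdist (cent c) x - rad c.
    by rewrite subr_gt0 ltNge; apply/negP => cx; apply: nAx; exists c.
  near=> i.
  have u0 : 0 < (u i)%:R :> R by rewrite ltr0n (U_gt0 (Uu i)).
  rewrite -ltrBrDl mulrA ltr_pdivrMr// -ltr_pdivrMl// mulrC.
  by near: i; exact: u_oo (nbhs_infty_gtr _).
(* As [ssS SS B w] is finite, one index [i] serves all its balls at once. *)
have [i /= iP] := filter_ex
  (filter_finite_bigcap _ _ _ _ _ _ (ssS_finite B w Uw) far).
have [c Sc] := ssA_near_ssS B x (u i) w (Uu i) Uw (Ax i I).
by rewrite leNgt iP.
Unshelve. all: by end_near. Qed.

End SplittingStructure.

Theorem theorem1 (R : realType) (X : metricType R) (HX : complete_metric X)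
    (SS : splitting_structure X) (B : cball X) (u v : nat -> nat)
    (Uu : forall i, ssU SS (u i)) (Uv : forall i, ssU SS (v i))
    (du : forall i, (u i %| u i.+1)%N) (dv : forall i, (v i %| v i.+1)%N)
    (u_oo : u @ \oo --> \oo) (v_oo : v @ \oo --> \oo) :
  \bigcap_i ssA SS (u i) B = \bigcap_i ssA SS (v i) B.
Proof.
(* For each inclusion, [w] runs through the terms of the other sequence. *)
by apply/seteqP; split; apply: sub_bigcap => i _; exact: bigcap_ssA_sub.
Qed.
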